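(* Let $n,s,t$ be positive integers and let $Z_{n,s,t}$ be the polynomial $$Z_{n,s,t}=\left(\sum_{i=1}^{sn}x_i\right)^{t-1}\prod_{j=1}^{n-1}\left(\sum_{i=1}^{sj}x_i\right)^{t}.$$ Then the set of distinct monomials in $Z_{n,s,t}$ is equinumerous with the set of lattice paths from $(0,0)$ to $(sn-1,tn-1)$ lying weakly beneath $U^{t-1}(R^sU^t)^{n-1}R^{s-1}$. Moreover, $$N(Z_{n,s,t})=\sum_{(k_1,\dots,k_n)\in L_{n,t}}\ \prod_{i=1}^n\binom{k_i+s-1}{k_i}=\frac1n\binom{(s+t)n-2}{n-1},$$ where $$L_{n,t}=\Big\{(k_1,\dots,k_n)\in\mathbb{N}^n:\ k_1+\cdots+k_j\le tj-1\text{ for }1\le j\le n,\ \sum_{j=1}^n k_j=tn-1\Big\}.$$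
   Context: $\mathbb{N}=\{0,1,2,\dots\}$. $N(Z_{n,s,t})$ denotes the number of nonzero coefficients of $Z_{n,s,t}$ (a polynomial with integer coefficients), i.e. the number of distinct monomials in its expansion. $U=(0,1)$ and $R=(1,0)$ denote up and right steps, and the lattice paths have steps $U$ and $R$; a word in $U,R$ denotes the lattice path starting at $(0,0)$ with those successive steps (exponents denote repetition). A path lies weakly beneath another with the same endpoints if it never goes strictly above it (it may touch it).
   Formalization: The final binomial is corrected from C((s+t)n−2, n−1) to C((s+t)n−2, sn−1), since the printed formula fails: for n=1, s=t=2, Z=x_1+x_2 has 2 monomials but the printed value is 1; the two agree when s=1 or t=1. *)

(* Defs.v *)
From HB Require Import structures.
From mathcomp Require Import all_boot all_order all_algebra.
From mathcomp Require Import mpoly.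

Set Implicit Arguments.
Unset Strict Implicit.
Unset Printing Implicit Defensive.

Import GRing.Theory.
Local Open Scope ring_scope.

(* The variables x_1, ..., x_(sn) are 'X_0, ..., 'X_(sn-1), so that
   x_1 + ... + x_(sj) is the sum of the 'X_i with i < s * j. *)
Definition Zpoly (n s t : nat) : {mpoly int[s * n]} :=
  (\sum_(i < s * n) 'X_i) ^+ (t - 1)
  * \prod_(1 <= j < n) (\sum_(i < s * n | (i < s * j)%N) 'X_i) ^+ t.

(* [msupp p] lists without repetition the monomials with nonzero
   coefficient in p. *)
Definition nb_monomials (m : nat) (p : {mpoly int[m]}) : nat := size (msupp p).

Local Open Scope nat_scope.

Definition step : Type := bool.
HB.instance Definition _ := Finite.on step.
Definition U : step := true.
Definition R : step := false.

Definition endpoint (w : seq step) : nat * nat :=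
  (count_mem R w, count_mem U w).

Definition vertices (w : seq step) : seq (nat * nat) :=
  [seq endpoint (take k w) | k <- iota 0 (size w).+1].

(* Testing the vertices is enough: paths are made of unit steps, and a right
   step of p running above q starts at a vertex of p that is above every
   vertex of q with the same abscissa. *)
Definition weakly_beneath (p q : seq step) : bool :=
  (endpoint p == endpoint q) &&
  all (fun a => has (fun b => (b.1 == a.1) && (a.2 <= b.2)) (vertices q))
      (vertices p).

Definition boundary (n s t : nat) : seq step :=
  nseq (t - 1) U ++ flatten (nseq (n - 1) (nseq s R ++ nseq t U))
    ++ nseq (s - 1) R.

Definition paths_beneath (n s t : nat) : pred (seq step) :=
  [pred w | (endpoint w == (s * n - 1, t * n - 1)) &&
            weakly_beneath w (boundary n s t)].

(* Coordinate j of the ordinal type is the 1-based index j + 1. *)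
Definition in_L (n t : nat) (k : 'I_n -> nat) : bool :=
  [forall j : 'I_n, \sum_(i < n | i <= j) k i <= t * j.+1 - 1]
  && (\sum_(i < n) k i == t * n - 1).

(* Hence, for n, t > 0, L_{n,t} is exhausted by the k : {ffun 'I_n -> 'I_(t * n)}
   satisfying [in_L]. *)
Lemma in_L_lt (n t : nat) (k : 'I_n -> nat) :
  0 < n -> 0 < t -> in_L t k -> forall i, k i < t * n.
Proof.
move=> n0 t0 /andP[_ /eqP sk] i.
have tn0 : 0 < t * n by rewrite muln_gt0 t0.
rewrite -(subnK tn0) addn1 ltnS -sk.
by rewrite (bigD1 i) //= leq_addr.
Qed.

(* Main.v *)
Require Import Defs.
From mathcomp Require Import all_boot all_order all_algebra.
From mathcomp Require Import mpoly zify.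

(* A product of sums x_1 + ... + x_b has nonnegative coefficients, and taking
   the widest factors first one sees that a monomial occurs in it exactly when
   it has the right degree and, for every c, its degree in the first c variables
   is at least the number of factors with b <= c.  For Z_{n,s,t}, reading the
   exponents a_1, ..., a_(sn) of a monomial backwards turns this into the upper
   bounds t j - 1 on the sums of the first s j of them.  These bounds say that
   the path U^(a_sn) R U^(a_(sn-1)) R ... R U^(a_1) stays below the boundary, and
   that the sums k_1, ..., k_n over consecutive blocks of s exponents are in
   L_{n,t}; there are C(k + s - 1, k) blocks of sum k.  Finally, by the cycle
   lemma exactly one of the n rotations of a k of total t n - 1 is in L_{n,t}, so
   that n N(Z_{n,s,t}) counts all families of s n exponents of sum t n - 1. *)

Set Implicit Arguments.
Unset Strict Implicit.
Unset Printing Implicit Defensive.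

Import Order.TTheory GRing.Theory Num.Theory.

(** * Supports of polynomials with nonnegative coefficients *)

Definition coefs_ge0 (N : nat) (p : {mpoly int[N]}) : Prop :=
  forall m : 'X_{1..N}, (0 <= p@_m)%R.

Lemma coefs_ge0X (N : nat) (u : 'X_{1..N}) : coefs_ge0 'X_[u].
Proof. by move=> m; rewrite mcoeffX ler0n. Qed.

Lemma coefs_ge0M (N : nat) (p q : {mpoly int[N]}) :
  coefs_ge0 p -> coefs_ge0 q -> coefs_ge0 (p * q)%R.
Proof.
by move=> p0 q0 m; rewrite mcoeffM sumr_ge0 // => k _; rewrite mulr_ge0.
Qed.

Lemma coefs_ge0_sum (N : nat) (I : Type) (r : seq I) (P : pred I)
    (F : I -> {mpoly int[N]}) :
  (forall i, P i -> coefs_ge0 (F i)) ->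
  coefs_ge0 (\sum_(i <- r | P i) F i)%R.
Proof.
by move=> F0 m; rewrite raddf_sum sumr_ge0 // => i Pi; apply: F0.
Qed.

(** No cancellation can occur: a sum of two nonnegative integers vanishes only if both do. *)
Lemma mem_msuppD_nneg (N : nat) (p q : {mpoly int[N]}) (m : 'X_{1..N}) :
  coefs_ge0 p -> coefs_ge0 q ->
  (m \in msupp (p + q)%R) = (m \in msupp p) || (m \in msupp q).
Proof.
move=> /(_ m) pm /(_ m) qm.
by rewrite !mcoeff_msupp mcoeffD paddr_eq0 // negb_and.
Qed.

Lemma mem_msupp_sum_nneg (N : nat) (I : eqType) (r : seq I) (P : pred I)
    (F : I -> {mpoly int[N]}) (m : 'X_{1..N}) :
  (forall i, coefs_ge0 (F i)) ->
  (m \in msupp (\sum_(i <- r | P i) F i)%R)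
    = has (fun i => P i && (m \in msupp (F i))) r.
Proof.
move=> F_ge0; elim: r => [|i r IHr] /=; first by rewrite big_nil msupp0.
rewrite big_cons; case: ifP => //= _.
by rewrite mem_msuppD_nneg ?IHr //; apply: coefs_ge0_sum => j _; apply: F_ge0.
Qed.

Lemma mem_msuppMX (N : nat) (p : {mpoly int[N]}) (u m : 'X_{1..N}) :
  (m \in msupp (p * 'X_[u])%R) = (u <= m)%MM && ((m - u)%MM \in msupp p).
Proof.
rewrite (perm_mem (msuppMX _ _)); apply/mapP/andP => [[k pk ->]|[um pk]].
  by rewrite lem_addr // addmC addmK.
by exists (m - u)%MM; rewrite // addmC submK.
Qed.

(** * Monomials in products of sums of initial variables *)

Definition linear_form (N b : nat) : {mpoly int[N]} :=
  (\sum_(i < N | (i < b)%N) 'X_i)%R.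

Lemma coefs_ge0_linear_form (N b : nat) :
  coefs_ge0 (linear_form N b).
Proof. by apply: coefs_ge0_sum => i _; apply: coefs_ge0X. Qed.

Lemma coefs_ge0_prod_linear_form (N : nat) (l : seq nat) :
  coefs_ge0 (\prod_(b <- l) linear_form N b)%R.
Proof.
apply: (big_ind (@coefs_ge0 N)) => [m|p q|b _].
- by rewrite mcoeff1 ler0n.
- exact: coefs_ge0M.
exact: coefs_ge0_linear_form.
Qed.

Lemma mem_msupp_mul_linear_form (N b : nat) (p : {mpoly int[N]})
    (m : 'X_{1..N}) :
  coefs_ge0 p ->
  reflect (exists2 i : 'I_N, i < b & 0 < m i /\ (m - U_(i))%MM \in msupp p)
    (m \in msupp (linear_form N b * p)%R).
Proof.
move=> p_ge0; rewrite mulrC mulr_sumr mem_msupp_sum_nneg => [|i]; last first.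
  by apply: coefs_ge0M => //; apply: coefs_ge0X.
apply: (iffP hasP) => [[i _]|[i ib [mi_gt0 pm]]].
  by rewrite mem_msuppMX lep1mP => /and3P[ib mi pm]; exists i; rewrite // lt0n.
by exists i; rewrite ?mem_index_enum // ib mem_msuppMX lep1mP -lt0n mi_gt0.
Qed.

Definition prefix_sum (N : nat) (m : 'X_{1..N}) (c : nat) : nat :=
  \sum_(i < N | i < c) m i.

Lemma prefix_sum_mdeg (N : nat) (m : 'X_{1..N}) (c : nat) :
  (forall i : 'I_N, c <= i -> m i = 0) -> prefix_sum m c = mdeg m.
Proof.
move=> m0; rewrite mdegE /prefix_sum big_mkcond; apply: eq_bigr => i _.
by case: ltnP => // /m0.
Qed.

Lemma prefix_sumB1 (N : nat) (m : 'X_{1..N}) (i : 'I_N) (c : nat) :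
  0 < m i -> prefix_sum m c = prefix_sum (m - U_(i))%MM c + (i < c).
Proof.
move=> mi; rewrite /prefix_sum; have [ic|ci] := boolP (i < c).
  rewrite (bigD1 i) //= [in RHS](bigD1 i) //= mnmBE mnm1E eqxx addnAC subnK //.
  congr (_ + _).
  apply: eq_bigr => j /andP[_ ji].
  by rewrite mnmBE mnm1E eq_sym (negPf ji) subn0.
rewrite addn0; apply: eq_bigr => j jc; rewrite mnmBE mnm1E.
by case: eqP => [ij|_]; rewrite ?subn0 //; rewrite ij jc in ci.
Qed.

Lemma prefix_sum_le (N : nat) (m : 'X_{1..N}) (c : nat) :
  prefix_sum m c <= mdeg m.
Proof.
by rewrite mdegE /prefix_sum big_mkcond leq_sum // => i _; case: ifP.
Qed.

Lemma mdegB1 (N : nat) (m : 'X_{1..N}) (i : 'I_N) :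
  0 < m i -> mdeg m = (mdeg (m - U_(i))%MM).+1.
Proof.
move=> mi; rewrite -(addn1 (mdeg _)) -(mdeg1 i) -mdegD submK //.
by rewrite lep1mP -lt0n.
Qed.

Lemma prefix_sum_mono (N : nat) (m : 'X_{1..N}) (c d : nat) :
  c <= d -> prefix_sum m c <= prefix_sum m d.
Proof.
move=> cd; rewrite /prefix_sum big_mkcond [leqRHS]big_mkcond leq_sum // => i _.
by case: (ltnP i c) => // ic; rewrite (leq_trans ic cd).
Qed.

(* The last variable of a monomial is the one to attribute to the widest
   factor: this lowers no prefix sum except the total degree. *)
Lemma mem_msupp_prod_linear_form_sorted (N : nat) (l : seq nat)
    (m : 'X_{1..N}) :
  sorted geq l ->
  m \in msupp (\prod_(b <- l) linear_form N b)%R <->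
  mdeg m = size l /\ forall c, count (fun b => b <= c) l <= prefix_sum m c.
Proof.
elim: l m => [|b l IHl] m /=.
  rewrite big_nil msupp1 inE -mdeg_eq0 => _.
  by split=> [/eqP->//|[-> _]].
move=> pl; have /IHl {}IHl := path_sorted pl.
(* The list is decreasing, so a [c] that reaches its head [b] reaches all its entries. *)
have lb : forall c, b <= c -> count (fun b' => b' <= c) l = size l.
  move=> c bc; apply/eqP; rewrite -all_count; apply/allP => x xl.
  have := order_path_min (rev_trans leq_trans) pl.
  by move=> /allP/(_ x xl) xb; apply: leq_trans bc.
rewrite big_cons; split.
  case/(mem_msupp_mul_linear_form _ _ (@coefs_ge0_prod_linear_form N l)).
  move=> i ib [mi /IHl[dm sm]]; rewrite (mdegB1 mi) dm; split=> // c.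
  rewrite (prefix_sumB1 _ mi) addnC leq_add //.
  (* If the new factor counts for [c], then i < b <= c, so the new variable also counts. *)
  by case: (leqP b c) => // bc; rewrite (leq_trans ib bc).
case=> dm sm.
apply/(mem_msupp_mul_linear_form _ _ (@coefs_ge0_prod_linear_form N l)).
have [i0 mi0] : exists i : 'I_N, 0 < m i.
  apply/existsP; apply: contraT; rewrite negb_exists => /forallP m0.
  have : mdeg m = 0; last by rewrite dm.
  by rewrite mdegE big1 // => i _; apply/eqP; rewrite -leqn0 leqNgt m0.
(* The variable to remove is the last one that occurs in [m]. *)
case: (@arg_maxnP _ i0 (fun i => 0 < m i) (@nat_of_ord N)) => // i mi i_max.
have m0 (j : 'I_N) : i < j -> m j = 0.
  move=> ij; apply/eqP; rewrite -leqn0 leqNgt; apply: contraL ij => mj.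
  by rewrite -leqNgt; apply: i_max.
have dm' := mdegB1 mi; have {}dm' : mdeg (m - U_(i))%MM = size l by lia.
exists i; last first.
  split=> //; apply/IHl; split=> // c.
  (* For [c] beyond [i] the prefix is the whole monomial, of degree [size l]; otherwise removing the
     variable leaves the prefix sum unchanged. *)
  have [ic|ci] := ltnP i c.
    rewrite (prefix_sum_mdeg (c := c)) ?dm' ?count_size // => j cj.
    by rewrite mnmBE m0 // (leq_trans ic cj).
  have := sm c; rewrite (prefix_sumB1 _ mi) (ltnNge i) ci addn0.
  by apply: leq_trans; rewrite leq_addl.
(* If b <= i, the condition at [b] would ask for a prefix sum of at least [size l] + 1 without the
   variable [i], and only degree [size l] remains. *)
rewrite ltnNge; apply/negP => bi; have := sm b.
rewrite leqnn lb // (prefix_sumB1 _ mi) (ltnNge i) bi addn0.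
by have := prefix_sum_le (m - U_(i)) b; lia.
Qed.

(** Both sides are unchanged when the factors are permuted, so they may be sorted. *)
Lemma mem_msupp_prod_linear_form (N : nat) (l : seq nat) (m : 'X_{1..N}) :
  m \in msupp (\prod_(b <- l) linear_form N b)%R <->
  mdeg m = size l /\ forall c, count (fun b => b <= c) l <= prefix_sum m c.
Proof.
have ll : perm_eq (sort geq l) l by rewrite perm_sort.
rewrite -(perm_big _ ll) /= -(perm_size ll).
have -> : (forall c, count (leq^~ c) l <= prefix_sum m c) <->
    (forall c, count (leq^~ c) (sort geq l) <= prefix_sum m c).
  by split=> lm c; have := lm c; rewrite (permP ll).
apply: mem_msupp_prod_linear_form_sorted; apply: sort_sorted => b c.
exact: leq_total.
Qed.

(** * The monomials of Z_{n,s,t} *)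

Lemma ZpolyE (n s t : nat) :
  Zpoly n s t = (\prod_(b <- nseq (t - 1) (s * n)%N
     ++ flatten [seq nseq t (s * j)%N | j <- index_iota 1 n])
        linear_form (s * n) b)%R.
Proof.
rewrite big_cat big_flatten big_map big_nseq iter_mulr_1 /Zpoly.
congr (_ ^+ _ * _)%R; first by apply: eq_bigl => i; rewrite ltn_ord.
by apply: eq_bigr => j _; rewrite big_nseq iter_mulr_1.
Qed.

(** With q = c / s this counts the factors of width at most [c] in the product of t-th powers. *)
Lemma sum_indicator_leq (n q t : nat) :
  \sum_(1 <= i < n) (i <= q) * t = t * minn q (n - 1).
Proof.
elim: n => [|n IHn]; first by rewrite big_geq // minn0 muln0.
case: n IHn => [|n] IHn; first by rewrite big_geq // minn0 muln0.
by rewrite big_nat_recr //= IHn; case: leqP; nia.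
Qed.

(** The number of factors of width at most [c] jumps only at multiples of [s], while prefix sums
    increase, so multiples of [s] suffice. From s n on, the condition is the one on the degree. *)
Lemma mem_msupp_Zpoly (n s t : nat) (m : 'X_{1..s * n}) :
  0 < n -> 0 < s -> 0 < t ->
  m \in msupp (Zpoly n s t) <->
  mdeg m = t * n - 1 /\ forall j, j < n -> t * j <= prefix_sum m (s * j).
Proof.
move=> n0 s0 t0; rewrite ZpolyE mem_msupp_prod_linear_form.
set l := _ ++ _.
have count_l c : count (leq^~ c) l
    = (s * n <= c) * (t - 1) + t * minn (c %/ s) (n - 1).
  rewrite count_cat count_nseq -sum_indicator_leq; congr (_ + _).
  rewrite count_flatten sumnE !big_map; apply: eq_bigr => i _.
  by rewrite count_nseq leq_divRL // (mulnC s i).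
have -> : size l = t * n - 1.
  (* No factor is wider than s n, so the size is the count at c = s n. *)
  rewrite -(count_predT) -(@eq_in_count _ (leq^~ (s * n))) => [|b].
    by rewrite count_l leqnn mulKn //; nia.
  rewrite mem_cat => /orP[/nseqP[-> _]|/flatten_mapP[j]].
    by rewrite leqnn.
  rewrite mem_index_iota => /andP[_ jn] /nseqP[-> _].
  by rewrite leq_pmul2l // ltnW.
split=> -[dm sm]; split=> //.
  move=> j jn; have := sm (s * j).
  rewrite count_l leq_pmul2l // (leqNgt n j) jn mulKn //.
  by apply: leq_trans; nia.
move=> c; rewrite count_l; have [nc|cn] := leqP (s * n) c.
  rewrite prefix_sum_mdeg ?dm; last first.
    by move=> i ci; have := ltn_ord i; rewrite ltnNge (leq_trans nc ci).
  by move: nc; rewrite mulnC -leq_divRL //; nia.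
have qn : c %/ s < n by rewrite ltn_divLR // mulnC.
have /sm qm := qn.
have -> : minn (c %/ s) (n - 1) = c %/ s by lia.
by rewrite (leq_trans qm) // prefix_sum_mono // mulnC leq_divM.
Qed.

(** * Lattice paths as sequences of column heights *)

(* A path with c right steps is encoded by the c + 1 numbers of up steps made
   at the abscissas 0, ..., c. *)
Fixpoint column_ups (w : seq step) : seq nat :=
  if w is a :: w' then
    let l := column_ups w' in
    if a == U then (head 0 l).+1 :: behead l else 0 :: l
  else [:: 0].

Definition path_of_ups (l : seq nat) : seq step :=
  nseq (head 0 l) U ++ flatten [seq R :: nseq y U | y <- behead l].

Lemma stepP (a : step) : a = U \/ a = R.
Proof. by case: a; [left | right]. Qed.

Lemma column_ups_cons (w : seq step) :
  column_ups w = head 0 (column_ups w) :: behead (column_ups w).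
Proof. by case: w => //= a w; case: ifP. Qed.

Lemma column_upsK : cancel column_ups path_of_ups.
Proof.
elim=> //= a w IHw; case: (stepP a) => -> /=.
  by rewrite -[in RHS]IHw.
by rewrite -[in RHS]IHw column_ups_cons.
Qed.

Lemma column_ups_nseqU (k : nat) (w : seq step) :
  column_ups (nseq k U ++ w)
    = (k + head 0 (column_ups w)) :: behead (column_ups w).
Proof. by elim: k => [|k IHk] /=; rewrite -?column_ups_cons // IHk. Qed.

Lemma path_of_upsK (x : nat) (l : seq nat) :
  column_ups (path_of_ups (x :: l)) = x :: l.
Proof.
elim: l x => [|y l IHl] x;
  rewrite /path_of_ups /= column_ups_nseqU /= ?addn0 //.
by have := IHl y; rewrite /path_of_ups /= => ->.
Qed.

Lemma size_column_ups (w : seq step) : size (column_ups w) = (count_mem R w).+1.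
Proof.
elim: w => //= a w IHw; case: (stepP a) => -> /=; last by rewrite IHw.
by rewrite -IHw [in RHS]column_ups_cons.
Qed.

Lemma sumn_column_ups (w : seq step) : sumn (column_ups w) = count_mem U w.
Proof.
elim: w => //= a w IHw; case: (stepP a) => -> /=; last by rewrite IHw.
by rewrite -IHw [in RHS]column_ups_cons.
Qed.

(* At abscissa x the path climbs from ordinate [height w x] to ordinate
   [height w x.+1]. *)
Definition height (w : seq step) (x : nat) : nat :=
  sumn (take x (column_ups w)).

Lemma height0 (w : seq step) : height w 0 = 0.
Proof. by rewrite /height take0. Qed.

Lemma heightU (w : seq step) (x : nat) :
  height (U :: w) x.+1 = (height w x.+1).+1.
Proof. by rewrite /height /= [in RHS]column_ups_cons. Qed.

Lemma heightR (w : seq step) (x : nat) : height (R :: w) x.+1 = height w x.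
Proof. by []. Qed.

Lemma vertices_cons (a : step) (w : seq step) :
  vertices (a :: w) = (0, 0)
    :: [seq (if a == U then (b.1, b.2.+1) else (b.1.+1, b.2))
         | b <- vertices w].
Proof.
have -> : vertices (a :: w)
    = [seq endpoint (take k (a :: w)) | k <- 0 :: map S (iota 0 (size w).+1)].
  by rewrite -[map S _]/(map (addn 1) _) -iotaDl.
rewrite map_cons -map_comp -map_comp; congr (_ :: _).
apply: eq_map => k /=.
by rewrite /endpoint /=; case: (stepP a) => ->.
Qed.

(** A first step [U] raises the remaining vertices by one and a first step [R] moves them right by
    one. The abscissa is bounded explicitly because [height] stays constant past the last column. *)
Lemma mem_vertices (w : seq step) (a : nat * nat) :
  (a \in vertices w)
    = (a.1 <= count_mem R w) && (height w a.1 <= a.2 <= height w a.1.+1).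
Proof.
elim: w a => [|c w IHw] [x y].
  by rewrite /vertices /= inE /height; case: x => [|x]; case: y.
rewrite vertices_cons inE; case: (stepP c) => -> /=.
  have -> : ((x, y) \in [seq (b.1, b.2.+1) | b <- vertices w])
      = (0 < y) && ((x, y.-1) \in vertices w).
    apply/mapP/andP => [[[x' y'] b /= [-> ->]]|[y0 b]] //.
    by exists (x, y.-1); rewrite //= prednK.
  rewrite IHw /= heightU; case: x => [|x]; rewrite ?heightU; last first.
    by case: y => [|y]; rewrite ?ltnS ?andbF.
 by case: y => [|y] /=; rewrite ?height0.
have -> : ((x, y) \in [seq (b.1.+1, b.2) | b <- vertices w])
    = (0 < x) && ((x.-1, y) \in vertices w).
  apply/mapP/andP => [[[x' y'] b /= [-> ->]]|[x0 b]] //.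
  by exists (x.-1, y); rewrite //= prednK.
by rewrite IHw; case: x => [|x]; rewrite ?heightR ?height0 /=; case: y.
Qed.

Lemma height_mono (w : seq step) (x : nat) : height w x <= height w x.+1.
Proof.
rewrite /height; elim: x (column_ups w) => [|x IHx] [|y l] //=.
by rewrite leq_add2l; apply: IHx.
Qed.

(** Only the topmost vertex of each path over a given abscissa matters, and its ordinate is
    [height _ x.+1]. *)
Lemma weakly_beneathP (p q : seq step) :
  reflect (endpoint p = endpoint q /\
      forall x, x <= count_mem R p -> height p x.+1 <= height q x.+1)
    (weakly_beneath p q).
Proof.
apply: (iffP andP) => [[/eqP epq /allP pq]|[epq pq]]; split=> //.
- move=> x xp; have /pq/hasP[b] : (x, height p x.+1) \in vertices p.
    by rewrite mem_vertices /= xp height_mono leqnn.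
  rewrite mem_vertices /= => /and3P[_ _ bq] /andP[/eqP <- pb].
  exact: leq_trans bq.
- exact/eqP.
apply/allP => a; rewrite mem_vertices => /and3P[ap _ ah].
apply/hasP; exists (a.1, height q a.1.+1) => /=; last first.
  by rewrite eqxx (leq_trans ah) ?pq.
rewrite mem_vertices /= height_mono leqnn !andbT.
by have /= <- := congr1 fst epq.
Qed.

Lemma height_nseqU (k x : nat) (w : seq step) :
  height (nseq k U ++ w) x.+1 = k + height w x.+1.
Proof. by elim: k => //= k IHk; rewrite heightU IHk. Qed.

Lemma height_nseqR (k x : nat) (w : seq step) :
  height (nseq k R ++ w) x = height w (x - k).
Proof.
by elim: k x => [|k IHk] [|x] //=; rewrite ?height0 // heightR IHk.
Qed.

Lemma endpoint_cat (u v : seq step) :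
  endpoint (u ++ v)
    = ((endpoint u).1 + (endpoint v).1, (endpoint u).2 + (endpoint v).2).
Proof. by rewrite /endpoint !count_cat. Qed.

Lemma endpoint_nseq (k : nat) :
  (endpoint (nseq k U) = (0, k)) * (endpoint (nseq k R) = (k, 0)).
Proof. by rewrite /endpoint !count_nseq /= !mul1n !mul0n. Qed.

Lemma endpoint_boundary (n s t : nat) : 0 < n -> 0 < s -> 0 < t ->
  endpoint (boundary n s t) = (s * n - 1, t * n - 1).
Proof.
move=> n0 s0 t0.
have endpoint_stairs k :
    endpoint (flatten (nseq k (nseq s R ++ nseq t U))) = (s * k, t * k).
  elim: k => [|k IHk]; first by rewrite !muln0.
  by rewrite /= !endpoint_cat IHk !endpoint_nseq /= !mulnS; congr (_, _); lia.
rewrite /boundary !endpoint_cat endpoint_stairs !endpoint_nseq /=.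
by congr (_, _); nia.
Qed.

(** The t - 1 initial up steps are followed by [t] more at each positive multiple of [s] up to
    [x]. *)
Lemma height_boundary (n s t x : nat) : 0 < n -> 0 < s -> 0 < t -> x < s * n ->
  height (boundary n s t) x.+1 = t * (x %/ s).+1 - 1.
Proof.
move=> n0 s0 t0 xsn.
have height_stairs k y : y < s * k.+1 ->
    height (flatten (nseq k (nseq s R ++ nseq t U)) ++ nseq (s - 1) R) y.+1
      = t * (y %/ s).
  elim: k y => [|k IHk] y ys /=.
    (* Only the final right steps remain here, so both sides are 0. *)
    rewrite -[nseq _ _]cats0 height_nseqR divn_small ?muln0; last by lia.
    have -> : y.+1 - (s - 1) = (y - s.-1).+1 - (y < s.-1) by lia.
    by rewrite /height /=; case: (_ - _) => //= -[].
  (* Before abscissa [s] the first block has not climbed yet; from there on, removing that block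
     shifts the abscissa by [s]. *)
  rewrite -!catA height_nseqR; have [ys'|sy] := ltnP y s.
    by rewrite divn_small // (eqP (ys' : y.+1 - s == 0)) muln0 /height take0.
  rewrite subSn // height_nseqU IHk; last by nia.
  by rewrite -{2}(subnK sy) divnDr // divnn s0 addn1 mulnS.
rewrite /boundary height_nseqU height_stairs; last by rewrite subn1 prednK.
by rewrite mulnS addnBAC.
Qed.

(** The boundary has constant top ordinate over each block of [s] abscissas, while a path only
    climbs, so the last abscissa of each block is enough. *)
Lemma paths_beneathP (n s t : nat) (w : seq step) :
  0 < n -> 0 < s -> 0 < t ->
  reflect [/\ size (column_ups w) = s * n, sumn (column_ups w) = t * n - 1
    & forall j, j < n -> sumn (take (s * j.+1) (column_ups w)) <= t * j.+1 - 1]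
    (w \in paths_beneath n s t).
Proof.
move=> n0 s0 t0; rewrite inE size_column_ups sumn_column_ups.
have sn0 : 0 < s * n by rewrite muln_gt0 s0.
apply: (iffP andP) => [[/eqP[wR wU] /weakly_beneathP[_ wb]]|[wR wU wL]].
  split=> //; first by rewrite wR; lia.
  move=> j jn; have := wb (s * j.+1).-1; rewrite wR.
  have sjn : s * j.+1 <= s * n by rewrite leq_pmul2l.
  have sj0 : 0 < s * j.+1 by rewrite muln_gt0 s0.
  rewrite -subn1 leq_sub2r // height_boundary //; last by lia.
  move=> /(_ isT); rewrite subn1 prednK // /height => /leq_trans -> //.
  have -> : (s * j.+1).-1 %/ s = j; last by [].
  by apply/eqP; rewrite eqn_leq -ltnS ltn_divLR // leq_divRL //; nia.
have ew : endpoint w = (s * n - 1, t * n - 1).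
  by rewrite -wR -wU subn1.
rewrite ew eqxx; split=> //; apply/weakly_beneathP.
rewrite endpoint_boundary //; split=> // x xw.
have xsn : x < s * n by rewrite -wR ltnS.
rewrite height_boundary //.
have jn : x %/ s < n by rewrite ltn_divLR // mulnC.
apply: leq_trans (wL _ jn).
have : x.+1 <= s * (x %/ s).+1 by rewrite mulnC ltn_ceil.
rewrite /height; move: (s * _) => d /subnK <-; rewrite addnC takeD sumn_cat.
exact: leq_addr.
Qed.

(** * The bijection between monomials and paths *)

Definition path_of_monomial (N : nat) (m : 'X_{1..N}) : seq step :=
  path_of_ups (rev m).

Lemma size_mnm (N : nat) (m : 'X_{1..N}) : size m = N.
Proof. exact: size_tuple. Qed.

Lemma column_ups_path_of_monomial (N : nat) (m : 'X_{1..N}) :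
  0 < N -> column_ups (path_of_monomial m) = rev m.
Proof.
rewrite -{1}(size_mnm m) -size_rev /path_of_monomial.
by case: (rev m) => // x l _; rewrite path_of_upsK.
Qed.

Lemma sumn_take (l : seq nat) (N c : nat) :
  size l = N -> sumn (take c l) = \sum_(i < N | i < c) nth 0 l i.
Proof.
move=> <-; elim: l c => [|x l IHl] [|c] //=; rewrite ?big_ord0 //.
  by rewrite big_pred0.
by rewrite IHl [RHS]big_mkcond big_ord_recl /= [in LHS]big_mkcond.
Qed.

Lemma prefix_sumE (N : nat) (m : 'X_{1..N}) (c : nat) :
  prefix_sum m c = sumn (take c m).
Proof.
by rewrite (sumn_take _ (size_mnm m)); apply: eq_bigr => i _; apply: mnm_nth.
Qed.

(* Read backwards, the exponents satisfy the constraints defining L_{n,t}. *)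
Lemma mem_msupp_Zpoly_rev (n s t : nat) (m : 'X_{1..s * n}) :
  0 < n -> 0 < s -> 0 < t ->
  m \in msupp (Zpoly n s t) <->
  sumn (rev m) = t * n - 1 /\
  forall j, j < n -> sumn (take (s * j.+1) (rev m)) <= t * j.+1 - 1.
Proof.
move=> n0 s0 t0; rewrite mem_msupp_Zpoly // sumn_rev.
have dm : mdeg m = sumn m by rewrite /mdeg sumnE.
have take_m j : j < n ->
    sumn (take (s * j.+1) (rev m)) + prefix_sum m (s * (n - j.+1)) = mdeg m.
  move=> jn; rewrite take_rev sumn_rev size_mnm -mulnBr prefix_sumE addnC.
  by rewrite -sumn_cat cat_take_drop.
(* Out of a total of t n - 1, a part is at least t (n - j - 1) exactly when the rest is at most t (j
   + 1) - 1. *)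
rewrite -dm; split=> [[sm mL]|[sm wL]]; split=> // j jn.
  have := take_m _ jn; have /mL : n - j.+1 < n by lia.
  by rewrite sm; move: (sumn _) (prefix_sum _ _); nia.
have /take_m : n - j.+1 < n by lia.
have /wL : n - j.+1 < n by lia.
by rewrite subnSK // sm (subKn (ltnW jn)); move: (sumn _) (prefix_sum _ _); nia.
Qed.

Lemma path_of_monomial_beneath (n s t : nat) (m : 'X_{1..s * n}) :
  0 < n -> 0 < s -> 0 < t ->
  path_of_monomial m \in paths_beneath n s t <-> m \in msupp (Zpoly n s t).
Proof.
move=> n0 s0 t0; have sn0 : 0 < s * n by rewrite muln_gt0 s0.
rewrite mem_msupp_Zpoly_rev //.
apply: (iff_trans (iff_sym (rwP (paths_beneathP _ n0 s0 t0)))).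
rewrite column_ups_path_of_monomial // size_rev size_mnm.
by split=> [[]|[]].
Qed.

Lemma path_of_monomial_inj (N : nat) :
  0 < N -> injective (@path_of_monomial N).
Proof.
move=> N0 m1 m2 /(congr1 column_ups).
rewrite !column_ups_path_of_monomial // => /(can_inj revK) m12.
by do 2!apply: val_inj.
Qed.

Lemma paths_beneath_monomial (n s t : nat) :
  0 < n -> 0 < s -> 0 < t ->
  [seq path_of_monomial m | m <- msupp (Zpoly n s t)] =i paths_beneath n s t.
Proof.
move=> n0 s0 t0 w; apply/mapP/idP => [[m mZ ->]|wP].
  by apply/path_of_monomial_beneath.
have /(paths_beneathP _ n0 s0 t0)[/eqP sw _ _] := wP.
have sw' : size (rev (column_ups w)) == s * n by rewrite size_rev.
exists [multinom Tuple sw'].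
  apply/path_of_monomial_beneath => //.
  by rewrite /path_of_monomial /= revK column_upsK.
by rewrite /path_of_monomial /= revK column_upsK.
Qed.

(** * Counting families of exponents by their sums *)

(** Stars and bars. The bound [M] only makes the type finite: values of sum [T] are at most T <
    M. *)
Lemma card_ffun_sum (I : finType) (M T : nat) : 0 < #|I| -> T < M ->
  #|[pred f : {ffun I -> 'I_M} | \sum_i f i == T]| = 'C(T + #|I| - 1, T).
Proof.
move=> I0 TM; pose widen := widen_ord TM.
have card_tuples : #|[set u : #|I|.-tuple 'I_T.+1 | \sum_(x <- u) x == T]|
    = 'C(T + #|I| - 1, T).
  move: #|I| I0 => [//|N] _; rewrite card_ord_partitions addnS subn1 addnC.
  by rewrite -(bin_sub (leq_addr N T)) addKn.
pose h (u : #|I|.-tuple 'I_T.+1) : {ffun I -> 'I_M} :=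
  Finfun (map_tuple widen u).
have h_sum u : \sum_i h u i = \sum_(x <- u) x.
  rewrite -(big_map widen predT (fun x : 'I_M => x : nat)).
  have -> : map widen u = codom (h u) by rewrite codom_ffun FinfunK.
  by rewrite big_map big_enum.
have h_inj : injective h.
  move=> u v /(can_inj (@FinfunK _ _)) /(congr1 val) /= uv.
  by apply/val_inj; apply: inj_map uv => x y /(congr1 val) /= /val_inj.
rewrite -card_tuples -(card_imset _ h_inj); apply: eq_card => f; rewrite inE.
apply/eqP/imsetP => [fT|[u]]; last by rewrite inE => /eqP <- ->; rewrite h_sum.
have f_le i : f i < T.+1 by rewrite ltnS -fT (bigD1 i) //= leq_addr.
pose g : {ffun I -> 'I_T.+1} := [ffun i => Ordinal (f_le i)].
have fE : f = h (fgraph g).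
  apply: (can_inj (@fgraphK _ _)); rewrite FinfunK; apply: val_inj => /=.
  rewrite /codom /image_mem -map_comp; apply: eq_map => i /=.
  by apply: val_inj; rewrite /= ffunE.
by exists (fgraph g); rewrite // inE -h_sum -fE; apply/eqP.
Qed.

(** The families [F] are grouped by their block sums k_j; the fibre over [k] is a product of sets of
    [s] numbers with sum k_j. *)
Lemma sum_prod_binomial (n s M : nat) (P : pred ('I_n -> nat)) :
  0 < s -> 0 < M ->
  (forall k1 k2, k1 =1 k2 -> P k1 = P k2) ->
  (forall k, P k -> forall j, k j < M) ->
  \sum_(k : {ffun 'I_n -> 'I_M} | P (fun j => k j))
     \prod_(j < n) 'C(k j + s - 1, k j)
  = #|[pred F : {ffun 'I_n -> {ffun 'I_s -> 'I_M}}
        | P (fun j => \sum_i F j i)]|.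
Proof.
move=> s0; case: M => // M _ P_ext P_lt; symmetry; rewrite -sum1_card.
(* Under [P] the block sums are below the bound, so [inord] does not alter them. *)
pose K (F : {ffun 'I_n -> {ffun 'I_s -> 'I_M.+1}}) : {ffun 'I_n -> 'I_M.+1} :=
  [ffun j => inord (\sum_i F j i)].
rewrite (partition_big K (fun k => P (fun j => k j))) => [|F PF]; last first.
  rewrite (P_ext _ (fun j => \sum_i F j i)) // => j.
  by rewrite ffunE inordK //; apply: (P_lt _ PF j).
apply: eq_bigr => k Pk; rewrite sum1_card.
pose fibre (j : 'I_n) := [pred f : {ffun 'I_s -> 'I_M.+1} | \sum_i f i == k j].
transitivity #|family fibre|; last first.
  rewrite card_family foldrE big_map big_enum; apply: eq_bigr => j _.
  by rewrite card_ffun_sum ?card_ord.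
apply: eq_card => F; rewrite !inE; apply/andP/familyP => [[PF /eqP Kk] j|Fk].
  by rewrite inE -Kk ffunE inordK //; apply: (P_lt _ PF j).
have Fk' j : \sum_i F j i = k j by have := Fk j; rewrite inE => /eqP.
split; first by rewrite unfold_in /= (P_ext _ (fun j => k j)).
by apply/eqP/ffunP => j; rewrite ffunE Fk' inord_val.
Qed.

(** Uncurrying gives a single family indexed by n s pairs. *)
Lemma card_ffun_sum2 (n s M T : nat) : 0 < n -> 0 < s -> T < M ->
  #|[pred F : {ffun 'I_n -> {ffun 'I_s -> 'I_M}} | \sum_j \sum_i F j i == T]|
  = 'C(T + n * s - 1, T).
Proof.
move=> n0 s0 TM.
have cardX : #|{: 'I_n * 'I_s}| = n * s by rewrite card_prod !card_ord.
rewrite -cardX -(card_ffun_sum _ TM) ?cardX ?muln_gt0 ?n0 //.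
pose uncurry (F : {ffun 'I_n -> {ffun 'I_s -> 'I_M}}) :
  {ffun 'I_n * 'I_s -> 'I_M} := [ffun p => F p.1 p.2].
have uncurry_inj : injective uncurry.
  move=> F G /ffunP FG; apply/ffunP => j; apply/ffunP => i.
  by have := FG (j, i); rewrite !ffunE.
rewrite -(card_image uncurry_inj); apply: eq_card => f; rewrite inE.
have uncurry_sum F : \sum_p uncurry F p = \sum_j \sum_i F j i.
  by rewrite pair_bigA; apply: eq_bigr => p _; rewrite ffunE.
apply/imageP/eqP => [[F /eqP <- ->] //|fT].
pose F : {ffun 'I_n -> {ffun 'I_s -> 'I_M}} := [ffun j => [ffun i => f (j, i)]].
have fE : f = uncurry F by apply/ffunP => -[j i]; rewrite !ffunE.
by exists F; rewrite // inE -uncurry_sum -fE fT.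
Qed.

(** * The cycle lemma and the closed formula *)

(** Taking the last maximum breaks ties, which makes the rotation of the cycle lemma unique. *)
Lemma last_maximum (D : nat -> int) (n : nat) :
  exists2 r, r <= n
    & forall i, i <= n -> (D i <= D r)%R /\ (r < i -> (D i < D r)%R).
Proof.
elim: n => [|n [r rn rmax]].
  by exists 0 => // i; rewrite leqn0 => /eqP ->.
have [Dn|Dn] := leP (D r) (D n.+1).
  exists n.+1 => // i; rewrite leq_eqVlt => /predU1P[->|].
    by split=> //; rewrite ltnn.
  by rewrite ltnS => i_n; have [Di _] := rmax i i_n; split; lia.
exists r; first exact: leqW.
move=> i; rewrite leq_eqVlt => /predU1P[->|]; last exact: rmax.
by split=> [|_]; rewrite ?(ltW Dn).
Qed.

Lemma eq_in_L (n t : nat) (k1 k2 : 'I_n -> nat) :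
  k1 =1 k2 -> in_L t k1 = in_L t k2.
Proof.
move=> k12; rewrite /in_L (eq_bigr k2) //; congr andb.
by apply: eq_forallb => j; rewrite (eq_bigr k2).
Qed.

(* Cycle lemma. With D i = k_0 + ... + k_(i-1) - t i, where k is extended
   periodically, D drops by 1 over each period, and the rotation starting at r
   is in L if and only if D stays below D r during the period following r. *)
Lemma cycle_lemma (n t : nat) (k : 'I_n.+1 -> nat) : 0 < t ->
  \sum_i k i = t * n.+1 - 1 ->
  exists r0, forall r, in_L t (fun i => k (i + r)%R) = (r == r0).
Proof.
move=> t0 k_sum.
(* Partial sums of the periodic extension of [k]; its period matches addition modulo n + 1 in
   ['I_n.+1]. *)
pose S m := \sum_(0 <= i < m) k (inord (i %% n.+1)).
have S_rot (r : 'I_n.+1) m : m <= n.+1 ->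
    S (r + m) = S r + \sum_(i < n.+1 | i < m) k (i + r)%R.
  move=> mn; rewrite /S (@big_cat_nat _ _ _ r) ?leq_addr //=; congr (_ + _).
  rewrite -{1}(add0n r) big_addn addKn big_mkord.
  rewrite (big_ord_widen _ (fun i => k (inord ((i + r) %% n.+1))) mn).
  apply: eq_bigr => i _; congr k; apply: val_inj.
  by rewrite /= inordK ?ltn_mod.
have rot_sum (r : 'I_n.+1) : \sum_i k (i + r)%R = t * n.+1 - 1.
  by rewrite -k_sum [in RHS](reindex_inj (addIr r)).
pose D m : int := ((S m)%:Z - (t * m)%:Z)%R.
have D_period (r : 'I_n.+1) : D (r + n.+1) = (D r - 1)%R.
  rewrite /D S_rot // (eq_bigl predT) => [|i]; last by rewrite ltn_ord.
  by rewrite rot_sum; nia.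
(* A partial sum is at most t m - 1 exactly when it is less than t m, hence the strict
   inequality. *)
have in_L_D (r : 'I_n.+1) :
    reflect (forall m, 0 < m <= n.+1 -> (D (r + m)%N < D r)%R)
    (in_L t (fun i => k (i + r)%R)).
  apply: (iffP andP) => [[/forallP rL _] [//|m] mn|rD].
    have := rL (Ordinal (mn : m < n.+1)); rewrite /= /D S_rot //.
    rewrite (eq_bigl (fun i : 'I_n.+1 => i <= m)) //.
    by move: (\sum_(_ < _ | _) _) (S r) => a b; nia.
  rewrite rot_sum eqxx; split=> //; apply/forallP => j.
  have := rD j.+1 (ltn_ord j); rewrite /D S_rot //.
  rewrite (eq_bigl (fun i : 'I_n.+1 => i <= j)) //.
  by move: (\sum_(_ < _ | _) _) (S r) => a b; nia.
have [r rn r_max] := last_maximum D n.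
exists (Ordinal (rn : r < n.+1)) => r'.
apply/in_L_D/eqP => [r'D|-> m /andP[m0 mn]].
  apply: val_inj => /=; have r'n := ltn_ord r'.
  (* If r' < r, the drop from [r'] to [r] contradicts maximality. If r < r', then D r - 1 = D (r + n
     + 1) < D r' contradicts D r' < D r. *)
  have [||//] := ltngtP r' r => [lt_r'|lt_r].
    have := r'D (r - r'); rewrite subnKC; last exact: ltnW.
    have [] := r_max r'; rewrite -1?ltnS // => le_r _; lia.
  have [_ /(_ lt_r) D_r'] := r_max r' r'n.
  have := r'D (r + n.+1 - r'); rewrite subnKC; last by lia.
  by rewrite (D_period (Ordinal (rn : r < n.+1))) /=; lia.
have [rm|mr] := leqP (r + m) n; first by have [_] := r_max _ rm; apply; lia.
(* Past index [n], going back one period gives a value at most D r, and [D] lost 1 over that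
   period. *)
have lt_i : r + m - n.+1 < n.+1 by lia.
have -> : r + m = Ordinal lt_i + n.+1 by rewrite /= subnK.
by rewrite D_period; have [] := r_max _ (lt_i : r + m - n.+1 <= n) => /=; lia.
Qed.

(** Pairs of a [k] of total t n - 1 and a rotation putting it in L are counted twice, weighted by
    [W], which rotations preserve: each [k] has one such rotation, and each rotation is a
    bijection. *)
Lemma mul_sum_in_L (n s t : nat) : 0 < n -> 0 < s -> 0 < t ->
  n * \sum_(k : {ffun 'I_n -> 'I_(t * n)} | in_L t (fun i => k i))
        \prod_(i < n) 'C(k i + s - 1, k i)
  = 'C((s + t) * n - 2, s * n - 1).
Proof.
case: n => // n _ s0 t0; set N := n.+1.
have tN0 : 0 < t * N by rewrite muln_gt0 t0.
pose W (k : {ffun 'I_N -> 'I_(t * N)}) := \prod_(i < N) 'C(k i + s - 1, k i).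
pose total (k : 'I_N -> nat) := \sum_i k i == t * N - 1.
pose rot (r : 'I_N) (k : {ffun 'I_N -> 'I_(t * N)}) :
  {ffun 'I_N -> 'I_(t * N)} := [ffun i => k (i + r)%R].
have rot_inj r : injective (rot r).
  move=> k1 k2 /ffunP k12; apply/ffunP => i; have := k12 (i - r)%R.
  by rewrite !ffunE subrK.
have W_rot r k : W (rot r k) = W k.
  rewrite /W [RHS](reindex_inj (addIr r)).
  by apply: eq_bigr => i _; rewrite ffunE.
have total_rot r k : total (fun i => rot r k i) = total (fun i => k i).
  rewrite /total [in RHS](reindex_inj (addIr r)).
  rewrite (eq_bigr (fun i => k (i + r)%R : nat)) //.
  by move=> i _; rewrite ffunE.
have in_L_total (k : 'I_N -> nat) : in_L t k -> total k by case/andP.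
transitivity (\sum_(k : {ffun 'I_N -> 'I_(t * N)} | total (fun i => k i)) W k);
  last first.
  rewrite sum_prod_binomial //; first last.
  - move=> k /eqP k_sum j; rewrite -ltnS -(subnK tN0) addn1 -k_sum.
    by rewrite (bigD1 j) //= !ltnS leq_addr.
  - by move=> k1 k2 k12; rewrite /total (eq_bigr k2).
  rewrite card_ffun_sum2 //; last by lia.
  (* Passing to the complement turns the lower index t n - 1 into s n - 1. *)
  rewrite -bin_sub; last by nia.
  by congr 'C(_, _); nia.
symmetry.
transitivity (\sum_(k : {ffun 'I_N -> 'I_(t * N)} | total (fun i => k i))
    \sum_(r | in_L t (fun i => rot r k i)) W k).
  apply: eq_bigr => k /eqP k_sum; have [r0 r0P] := cycle_lemma t0 k_sum.
  rewrite (big_pred1 r0) // => r /=; rewrite -r0P; apply: eq_in_L => i.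
  by rewrite ffunE.
rewrite (exchange_big_dep predT) //=.
transitivity (\sum_(r : 'I_N)
    \sum_(k : {ffun 'I_N -> 'I_(t * N)} | in_L t (fun i => k i)) W k);
  last first.
  by rewrite sum_nat_const card_ord.
apply: eq_bigr => r _; rewrite [RHS](reindex_inj (rot_inj r)).
apply: eq_big => k.
  by apply: andb_idl => /in_L_total; rewrite total_rot.
by rewrite W_rot.
Qed.

(** * The number of monomials *)

(** The entry [F j i] is the exponent at position j s + i when exponents are read backwards, so
    block sums become the k_j. *)
Lemma nb_monomials_Zpoly (n s t : nat) : 0 < n -> 0 < s -> 0 < t ->
  nb_monomials (Zpoly n s t)
  = #|[pred F : {ffun 'I_n -> {ffun 'I_s -> 'I_(t * n)}}
        | in_L t (fun j => \sum_i F j i)]|.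
Proof.
move=> n0 s0 t0; have tn0 : 0 < t * n by rewrite muln_gt0 t0.
have sn0 : 0 < s * n by rewrite muln_gt0 s0.
(* The default 0 arises only for x >= s n, outside the positions read by [h]. *)
pose entry (F : {ffun 'I_n -> {ffun 'I_s -> 'I_(t * n)}}) (x : nat) : nat :=
  if (insub (x %/ s), insub (x %% s)) is (Some j, Some i) then F j i else 0.
have entryE F (j : 'I_n) (i : 'I_s) : entry F (j * s + i) = F j i.
  by rewrite /entry divnMDl // divn_small ?addn0 // modnMDl modn_small // !valK.
pose h F : 'X_{1..s * n} := [multinom of rev (map (entry F) (iota 0 (s * n)))].
have rev_h F : rev (h F) = map (entry F) (iota 0 (s * n)) by rewrite revK.
have prefix_h F c : c <= n -> sumn (take (s * c) (rev (h F)))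
    = \sum_(j < n | j < c) \sum_i F j i.
  move=> cn; rewrite rev_h -map_take take_iota (minn_idPl _) ?leq_pmul2l //.
  rewrite sumnE big_map mulnC -[X in iota 0 X]subn0 big_nat_mul.
  rewrite big_mkord.
  rewrite (big_ord_widen _ (fun q => \sum_(q * s <= x < q.+1 * s) entry F x) cn).
  apply: eq_bigr => j _; rewrite -{1}[j * s]add0n big_addn mulSn addnK big_mkord.
  by apply: eq_bigr => i _; rewrite addnC entryE.
have mem_h F : h F \in msupp (Zpoly n s t) <-> in_L t (fun j => \sum_i F j i).
  rewrite mem_msupp_Zpoly_rev //.
  have -> : sumn (rev (h F)) = \sum_j \sum_i F j i.
    rewrite -[rev _](take_size) size_rev size_mnm prefix_h //.
    by apply: eq_bigl => j; rewrite ltn_ord.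
  split=> [[F_sum FL]|/andP[/forallP FL /eqP F_sum]].
    rewrite /in_L F_sum eqxx andbT; apply/forallP => j.
    by have := FL j (ltn_ord j); rewrite prefix_h.
  split=> // j jn; rewrite prefix_h //; exact: FL (Ordinal jn).
have nth_h F x : x < s * n -> nth 0 (rev (h F)) x = entry F x.
  by move=> xn; rewrite rev_h (nth_map 0) ?size_iota // nth_iota.
have h_inj : injective h.
  move=> F G FG; apply/ffunP => j; apply/ffunP => i; apply: val_inj.
  have ji : j * s + i < s * n by have := ltn_ord j; have := ltn_ord i; nia.
  by rewrite /= -!entryE -!nth_h // FG.
rewrite /nb_monomials cardE -(size_map h); apply: perm_size.
apply: uniq_perm; rewrite ?msupp_uniq ?(map_inj_uniq h_inj) ?enum_uniq // => m.
apply/idP/mapP => [mZ|[F]]; last first.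
  by rewrite mem_enum => FL ->; apply/mem_h.
have [m_sum _] := (mem_msupp_Zpoly_rev m n0 s0 t0).1 mZ.
(* No exponent exceeds the degree t n - 1, so all of them fit in ['I_(t * n)]. *)
have m_lt x : nth 0 (rev m) x < t * n.
  have [xm|mx] := ltnP x (size (rev m)); last by rewrite nth_default.
  rewrite -(subnK tn0) -m_sum addn1 ltnS sumnE (big_nth 0) big_mkord.
  by rewrite (bigD1 (Ordinal xm)) //= leq_addr.
pose F : {ffun 'I_n -> {ffun 'I_s -> 'I_(t * n)}} :=
  [ffun j : 'I_n => [ffun i : 'I_s => Ordinal (m_lt (j * s + i))]].
have mE : m = h F.
  suff: rev m = rev (h F) by move=> /(can_inj revK) mh; do 2!apply: val_inj.
  apply: (@eq_from_nth _ 0) => [|x].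
    by rewrite (size_rev m) (size_rev (h F)) (size_mnm m) (size_mnm (h F)).
  rewrite size_rev size_mnm => xn; rewrite nth_h //.
  have xs : x %% s < s by rewrite ltn_mod.
  have xq : x %/ s < n by rewrite ltn_divLR // mulnC.
  rewrite [in RHS](divn_eq x s) (entryE F (Ordinal xq) (Ordinal xs)) !ffunE /=.
  by rewrite -divn_eq.
by exists F; rewrite // mem_enum inE; apply/mem_h; rewrite -mE.
Qed.

Theorem corollary4p5 (n s t : nat)
    (hn : (0 < n)%N) (hs : (0 < s)%N) (ht : (0 < t)%N) :
  (exists f : 'X_{1..s * n} -> seq step,
     {in msupp (Zpoly n s t) &, injective f} /\
     [seq f m | m <- msupp (Zpoly n s t)] =i paths_beneath n s t) /\
  nb_monomials (Zpoly n s t) =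
    (\sum_(k : {ffun 'I_n -> 'I_(t * n)} | in_L t (fun i => k i))
       \prod_(i < n) 'C(k i + s - 1, k i))%N /\
  ((\sum_(k : {ffun 'I_n -> 'I_(t * n)} | in_L t (fun i => k i))
       \prod_(i < n) 'C(k i + s - 1, k i))%N%:R =
     (n%:R)^-1 * ('C((s + t) * n - 2, s * n - 1))%:R :> rat)%R.
Proof.
split; [|split].
- exists (@path_of_monomial (s * n)); split; last exact: paths_beneath_monomial.
  by move=> m1 m2 _ _; apply: path_of_monomial_inj; rewrite muln_gt0 hs.
- rewrite nb_monomials_Zpoly // sum_prod_binomial ?muln_gt0 ?ht //.
    exact: eq_in_L.
  by move=> k; apply: in_L_lt.
by rewrite -mul_sum_in_L // natrM mulKf // pnatr_eq0 -lt0n.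
Qed.
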